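(* Let $Q$ be a Dynkin quiver, $\mathbf{d}\in\mathbb{N}^{Q_0}$, and let $N$ be a point in $\mathrm{rep}_Q^{\mathbf{d}}(\Bbbk)$ with a fixed decomposition $N=\bigoplus_{s\in\mathcal{S}}N^s$ as a representation of $Q$. Consider the representation $L=N+\widehat{Z^{p,q}}$ in $\mathrm{rep}_Q^{\mathbf{d}}(\Bbbk)$ for $Z^{p,q}\in\mathbb{Z}^1_Q(N^q,N^p)$ and two indices $p\neq q$ in $\mathcal{S}$. Then the following conditions hold: (1) $\delta_{L,N}=\delta_{\sigma(N^p,Z^{p,q},N^q)}$. (2) $L$ degenerates to $N$, i.e. $N\in\overline{\mathcal{O}}_L(\Bbbk)$. (3) $L\simeq N$ if and only if $Z^{p,q}$ belongs to $\mathbb{B}^1_Q(N^q,N^p)$.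
   Context: $\Bbbk$ is an algebraically closed field; a Dynkin quiver is one whose underlying graph is of type $\mathbb{A}_n,\mathbb{D}_n,\mathbb{E}_6,\mathbb{E}_7,\mathbb{E}_8$; an arrow $\alpha$ goes from $s\alpha$ to $t\alpha$. $\mathrm{rep}_Q^{\mathbf{d}}=\prod_\alpha\mathbb{M}_{\mathbf{d}_{t\alpha}\times\mathbf{d}_{s\alpha}}$ with the conjugation action of $\mathrm{GL}_{\mathbf{d}}$; $\mathcal{O}_L$ is the orbit of points isomorphic to $L$ and $\overline{\mathcal{O}}_L$ its Zariski closure. For representations $U,V$: $\mathbb{Z}^1_Q(V,U)=\prod_\alpha\mathrm{Hom}_\Bbbk(V_{s\alpha},U_{t\alpha})$, and $\mathbb{B}^1_Q(V,U)\subseteq\mathbb{Z}^1_Q(V,U)$ is the image of the map $\prod_{a\in Q_0}\mathrm{Hom}_\Bbbk(V_a,U_a)\to\mathbb{Z}^1_Q(V,U)$, $h\mapsto(h_{t\alpha}V_\alpha-U_\alpha h_{s\alpha})_\alpha$. For $Z\in\mathbb{Z}^1_Q(V,U)$, $\sigma(U,Z,V)$ is the short exact sequence $0\to U\to W\to V\to0$ with $W_a=U_a\oplus V_a$, $W_\alpha=\begin{bmatrix}U_\alpha&Z_\alpha\\0&V_\alpha\end{bmatrix}$ and canonical maps. Given the decomposition of $N$ (so $\Bbbk^{\mathbf{d}_a}=\bigoplus_sN^s_a$), $\widehat{Z^{p,q}}\in\mathrm{rep}_Q^{\mathbf{d}}(\Bbbk)$ is the collection of maps $\Bbbk^{\mathbf{d}_{s\alpha}}\to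 N^q_{s\alpha}\xrightarrow{Z^{p,q}_\alpha}N^p_{t\alpha}\to\Bbbk^{\mathbf{d}_{t\alpha}}$ (canonical projection and inclusion); $N+\widehat{Z^{p,q}}$ is the sum in the vector space $\mathrm{rep}_Q^{\mathbf{d}}(\Bbbk)$. $[X,Y]=\dim_\Bbbk\mathrm{Hom}_Q(X,Y)$. For representations $M',N'$ with the same dimension vector, $\delta_{M',N'}$ is the function on isomorphism classes of non-projective indecomposable representations $X$ given by $\delta_{M',N'}(X)=[X,N']-[X,M']$; for a short exact sequence $\sigma:0\to A\to B\to C\to0$, $\delta_\sigma=\delta_{B,A\oplus C}$. *)

(* Defs.v *)
From HB Require Import structures.
From mathcomp Require Import all_boot all_order all_algebra.
From mathcomp Require Import mpoly.

Set Implicit Arguments.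
Unset Strict Implicit.
Unset Printing Implicit Defensive.

Import GRing.Theory.
Local Open Scope ring_scope.

(* Finite dependent products of vector spaces are vector spaces; the library
   only provides the non-dependent case.                                      *)
Section DffunZmod.
Variables (I : finType) (V : I -> zmodType).
Local Notation T := {dffun forall i, V i}.
Implicit Types f g h : T.

Definition dffun_zero : T := [ffun i => 0].
Definition dffun_opp f : T := [ffun i => - f i].
Definition dffun_add f g : T := [ffun i => f i + g i].

Fact dffun_addA : associative dffun_add.
Proof. by move=> f g h; apply/ffunP=> i; rewrite !ffunE addrA. Qed.
Fact dffun_addC : commutative dffun_add.
Proof. by move=> f g; apply/ffunP=> i; rewrite !ffunE addrC. Qed.
Fact dffun_add0 : left_id dffun_zero dffun_add.
Proof. by move=> f; apply/ffunP=> i; rewrite !ffunE add0r. Qed.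
Fact dffun_addN : left_inverse dffun_zero dffun_opp dffun_add.
Proof. by move=> f; apply/ffunP=> i; rewrite !ffunE addNr. Qed.

HB.instance Definition _ := GRing.isZmodule.Build T
  dffun_addA dffun_addC dffun_add0 dffun_addN.
End DffunZmod.

Section DffunLmod.
Variables (R : pzRingType) (I : finType) (V : I -> lmodType R).
Local Notation T := {dffun forall i, V i}.
Implicit Types f g : T.

Definition dffun_scale (a : R) f : T := [ffun i => a *: f i].

Fact dffun_scaleA a b f : dffun_scale a (dffun_scale b f) = dffun_scale (a * b) f.
Proof. by apply/ffunP=> i; rewrite !ffunE scalerA. Qed.
Fact dffun_scale1 : left_id 1 dffun_scale.
Proof. by move=> f; apply/ffunP=> i; rewrite !ffunE scale1r. Qed.
Fact dffun_scaleDr : right_distributive dffun_scale +%R.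
Proof. by move=> a f g; apply/ffunP=> i; rewrite !ffunE scalerDr. Qed.
Fact dffun_scaleDl f : {morph dffun_scale^~ f : a b / a + b}.
Proof. by move=> a b; apply/ffunP=> i; rewrite !ffunE scalerDl. Qed.

HB.instance Definition _ := GRing.Zmodule_isLmodule.Build R T
  dffun_scaleA dffun_scale1 dffun_scaleDr dffun_scaleDl.
End DffunLmod.

Section DffunVect.
Import VectorInternalTheory.
Variables (R : nzRingType) (I : finType) (V : I -> vectType R).
Local Notation T := {dffun forall i, V i}.
Local Notation J := {i : I & 'I_(dim (V i))}.

Fact dffun_vect_iso : Vector.axiom #|{: J}| T.
Proof.
exists (fun f : T => \row_(x < #|{: J}|)
          v2r (f (tag (enum_val x))) 0 (tagged (enum_val x))).
  by move=> a f g; apply/rowP=> x; rewrite !mxE !ffunE linearP !mxE.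
exists (fun r : 'rV[R]_#|{: J}| =>
          [ffun i => r2v (\row_j r 0 (enum_rank (Tagged _ j)))] : T).
  move=> f; apply/ffunP=> i; rewrite ffunE; apply: (canLR v2rK).
  by apply/rowP=> j; rewrite !mxE enum_rankK.
move=> r; apply/rowP=> x; rewrite !mxE ffunE r2vK mxE -{3}[x]enum_valK.
by case: (enum_val x).
Qed.

HB.instance Definition _ := Lmodule_hasFinDim.Build R T dffun_vect_iso.
End DffunVect.

Record quiver := Quiver {
  vertex : finType;
  arrow : finType;
  src : arrow -> vertex;
  tgt : arrow -> vertex }.

(* The underlying graph of Q is the simple graph on 'I_n with adjacency e;
   counting arrows excludes loops and multiple edges.                         *)
Definition has_underlying_graph (Q : quiver) (n : nat) (e : rel nat) : Prop :=
  exists2 f : vertex Q -> 'I_n, bijective f &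
    forall x y : vertex Q,
      #|[set a : arrow Q | ((src a == x) && (tgt a == y))
                        || ((src a == y) && (tgt a == x))]|
      = e (f x) (f y) :> nat.

(* 0 -- 1 -- ... -- n-1 *)
Definition path_graph : rel nat := fun i j => (i.+1 == j) || (j.+1 == i).

(* 0 -- 1 -- ... -- n-2, with n-1 attached to b *)
Definition branch_graph (n b : nat) : rel nat :=
  let e i j := [&& i.+1 == j & j < n.-1]%N || ((i == b) && (j == n.-1)) in
  fun i j => e i j || e j i.

Definition dynkin (Q : quiver) : Prop :=
  (exists2 n, (1 <= n)%N & has_underlying_graph Q n path_graph) \/
  (exists2 n, (4 <= n)%N & has_underlying_graph Q n (branch_graph n (n - 3))) \/
  has_underlying_graph Q 6 (branch_graph 6 2) \/
  has_underlying_graph Q 7 (branch_graph 7 2) \/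
  has_underlying_graph Q 8 (branch_graph 8 2).

Section Representations.
Variables (k : fieldType) (Q : quiver).

Record rep := Rep {
  rep_space :> vertex Q -> vectType k;
  rep_map : forall al : arrow Q, 'Hom(rep_space (src al), rep_space (tgt al)) }.

Definition vhom (X Y : rep) := {dffun forall a : vertex Q, 'Hom(X a, Y a)}.

Definition Z1 (V U : rep) := {dffun forall al : arrow Q, 'Hom(V (src al), U (tgt al))}.

Definition cobound_fun (V U : rep) (h : vhom V U) : Z1 V U :=
  [ffun al => ((h (tgt al) \o rep_map V al) - (rep_map U al \o h (src al)))%VF].

Fact cobound_is_linear (V U : rep) : linear (@cobound_fun V U).
Proof.
move=> a f g; apply/ffunP=> al; rewrite !ffunE.
apply/lfunP=> v; do !rewrite ?(lfunE, comp_lfunE, add_lfunE, opp_lfunE, scale_lfunE, ffunE) /=.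
by rewrite linearP /= opprD addrACA -scalerBr.
Qed.
HB.instance Definition _ (V U : rep) :=
  GRing.isLinear.Build k (vhom V U) (Z1 V U) _ (@cobound_fun V U) (@cobound_is_linear V U).

Definition cobound (V U : rep) : 'Hom(vhom V U, Z1 V U) := linfun (@cobound_fun V U).

Definition B1 (V U : rep) : {vspace Z1 V U} := limg (cobound V U).

(* Homomorphisms of representations, as the kernel of h |-> (h X_al - Y_al h). *)
Definition homQ (X Y : rep) : {vspace vhom X Y} := lker (cobound X Y).

Lemma homQP (X Y : rep) (h : vhom X Y) :
  reflect (forall al, (h (tgt al) \o rep_map X al = rep_map Y al \o h (src al))%VF)
          (h \in homQ X Y).
Proof.
rewrite memv_ker lfunE /=; apply: (iffP eqP) => [/ffunP h0 al|h0].
  by have := h0 al; rewrite !ffunE => /eqP; rewrite subr_eq0 => /eqP.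
by apply/ffunP=> al; rewrite !ffunE h0 subrr.
Qed.

Definition dim_hom (X Y : rep) : nat := \dim (homQ X Y).

Definition rep_iso (X Y : rep) : Prop :=
  exists f : vhom X Y, exists g : vhom Y X,
    [/\ f \in homQ X Y, g \in homQ Y X &
        forall a, (g a \o f a = \1)%VF /\ (f a \o g a = \1)%VF].

Definition ext_map (U V : rep) (Z : Z1 V U) (al : arrow Q)
    (w : U (src al) * V (src al)) : U (tgt al) * V (tgt al) :=
  (rep_map U al w.1 + Z al w.2, rep_map V al w.2).

Fact ext_map_is_linear (U V : rep) (Z : Z1 V U) al : linear (@ext_map U V Z al).
Proof.
move=> a w w'; rewrite /ext_map /= !linearP.
by congr (_, _); rewrite /= addrACA -scalerDr.
Qed.
HB.instance Definition _ (U V : rep) (Z : Z1 V U) (al : arrow Q) :=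
  GRing.isLinear.Build k _ _ _ (@ext_map U V Z al) (@ext_map_is_linear U V Z al).

(* W_a = U_a (+) V_a, with W_al the block matrix [U_al, Z_al; 0, V_al]. *)
Definition ext_rep (U V : rep) (Z : Z1 V U) : rep :=
  @Rep (fun a => (U a * V a)%type) (fun al => linfun (@ext_map U V Z al)).

Definition dsum (U V : rep) : rep := ext_rep (0 : Z1 V U).

Record ses (A B C : rep) := Ses {
  ses_inj : vhom A B;
  ses_proj : vhom B C;
  ses_inj_hom : ses_inj \in homQ A B;
  ses_proj_hom : ses_proj \in homQ B C;
  ses_injective : forall a, lker (ses_inj a) = 0%VS;
  ses_exact : forall a, limg (ses_inj a) = lker (ses_proj a);
  ses_surjective : forall a, limg (ses_proj a) = fullv }.

Section Sigma.
Variables (U V : rep) (Z : Z1 V U).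
Local Notation W := (ext_rep Z).

Definition inl_fun (a : vertex Q) (u : U a) : U a * V a := (u, 0).
Fact inl_is_linear a : linear (@inl_fun a).
Proof. by move=> c u u'; rewrite /inl_fun; congr (_, _); rewrite /= scaler0 addr0. Qed.
HB.instance Definition _ a := GRing.isLinear.Build k _ _ _ (@inl_fun a) (@inl_is_linear a).

Definition can_inj : vhom U W := [ffun a => linfun (@inl_fun a) : 'Hom(U a, W a)].
Definition can_proj : vhom W V :=
  [ffun a => linfun (snd : U a * V a -> V a) : 'Hom(W a, V a)].

Fact can_inj_hom : can_inj \in homQ U W.
Proof.
apply/homQP=> al; apply/lfunP=> u; rewrite !comp_lfunE !ffunE !lfunE /=.
by rewrite /ext_map /inl_fun /= !linear0 addr0.
Qed.
Fact can_proj_hom : can_proj \in homQ W V.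
Proof. by apply/homQP=> al; apply/lfunP=> w; rewrite !comp_lfunE !ffunE !lfunE. Qed.
Fact can_injective a : lker (can_inj a) = 0%VS.
Proof.
by apply/eqP/lker0P=> u u'; rewrite !ffunE !lfunE /= => -[].
Qed.
Fact can_exact a : limg (can_inj a) = lker (can_proj a).
Proof.
apply/vspaceP=> w; rewrite memv_ker !ffunE lfunE /=.
apply/memv_imgP/eqP => [[u _ ->]|]; first by rewrite lfunE.
by case: w => u v /= ->; exists u; rewrite ?memvf // lfunE.
Qed.
Fact can_surjective a : limg (can_proj a) = fullv.
Proof.
apply/vspaceP=> v; rewrite memvf; apply/memv_imgP.
by exists (0, v); rewrite ?memvf // !ffunE lfunE.
Qed.

Definition sigma : ses U W V :=
  Ses can_inj_hom can_proj_hom can_injective can_exact can_surjective.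
End Sigma.

Definition rep_zero (X : rep) : Prop := forall a, \dim {: X a} = 0%N.

Definition indecomposable (X : rep) : Prop :=
  ~ rep_zero X /\
  forall A B : rep, rep_iso X (dsum A B) -> rep_zero A \/ rep_zero B.

Definition projective (X : rep) : Prop :=
  forall (A B : rep) (f : vhom A B) (g : vhom X B),
    f \in homQ A B -> (forall a, limg (f a) = fullv) -> g \in homQ X B ->
    exists2 h : vhom X A, h \in homQ X A & forall a, (f a \o h a)%VF = g a.

(* Representatives of the isomorphism classes on which delta is defined; delta
   is invariant under isomorphism.                                            *)
Record np_indec := NpIndec {
  np_rep :> rep;
  np_indecomposable : indecomposable np_rep;
  np_nonprojective : ~ projective np_rep }.

Definition delta (M N : rep) (X : np_indec) : int :=
  (dim_hom X N)%:Z - (dim_hom X M)%:Z.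

Definition delta_ses (A B C : rep) (s : ses A B C) : np_indec -> int :=
  delta B (dsum A C).

Section Points.
Variable d : vertex Q -> nat.

Definition rep_pt := {dffun forall al : arrow Q, 'M[k]_(d (tgt al), d (src al))}.

Definition rep_of_pt (M : rep_pt) : rep :=
  @Rep (fun a => 'cV[k]_(d a)) (fun al => linfun (mulmx (M al))).

Definition orbit_pt (L M : rep_pt) : Prop :=
  exists2 g : forall a : vertex Q, 'M[k]_(d a), (forall a, g a \in unitmx) &
    forall al, M al = g (tgt al) *m L al *m invmx (g (src al)).

Definition coord_index := {al : arrow Q & ('I_(d (tgt al)) * 'I_(d (src al)))%type}.

Definition coords (M : rep_pt) (i : 'I_#|{: coord_index}|) : k :=
  let x := enum_val i in M (tag x) (tagged x).1 (tagged x).2.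

Definition zariski_closed (C : rep_pt -> Prop) : Prop :=
  exists E : {mpoly k[#|{: coord_index}|]} -> Prop,
    forall M, C M <-> (forall f, E f -> f.@[coords M] = 0).

Definition zariski_closure (A : rep_pt -> Prop) (M : rep_pt) : Prop :=
  forall C, zariski_closed C -> (forall X, A X -> C X) -> C M.

(* N = (+)_(s in S) N^s, as an internal direct sum of subrepresentations. *)
Record decomposition (S : finType) (N : rep_pt) := Decomposition {
  summand : S -> forall a : vertex Q, {vspace 'cV[k]_(d a)};
  summand_stable : forall s al,
    (linfun (mulmx (N al)) @: summand s (src al) <= summand s (tgt al))%VS;
  summand_full : forall a, fullv = (\sum_(s : S) summand s a)%VS;
  summand_direct : forall a, directv (\sum_(s : S) summand s a) }.

Section Decomposition.
Variables (S : finType) (N : rep_pt) (D : decomposition S N).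

(* vsproj inverts the inclusion vsval on the subspace, so by summand_stable
   this is the restriction of N.                                              *)
Definition summand_rep (s : S) : rep :=
  @Rep (fun a => subvs_of (summand D s a))
       (fun al => (linfun (vsproj (summand D s (tgt al)))
                   \o linfun (mulmx (N al)) \o linfun vsval)%VF).

Definition summand_proj (s : S) (a : vertex Q) :
    'Hom('cV[k]_(d a), summand_rep s a) :=
  (linfun (vsproj (summand D s a)) \o sumv_pi_for (summand_full D a) s)%VF.

Definition summand_incl (s : S) (a : vertex Q) :
    'Hom(summand_rep s a, 'cV[k]_(d a)) := linfun vsval.

Definition Zhat (p q : S) (Z : Z1 (summand_rep q) (summand_rep p)) : rep_pt :=
  [ffun al => \matrix_(i, j)
     (summand_incl p (tgt al) \o Z al \o summand_proj q (src al))%VF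
       (delta_mx j 0) i 0].
End Decomposition.

End Points.
End Representations.

(* Main.v *)
(* Let [W] be the middle term of [sigma Z] and [R] the sum of the summands of
   [N] other than [N^p] and [N^q].  Then [L] is isomorphic to [W (+) R], and
   [Z = 0] gives [N = N^p (+) N^q (+) R]; since [dim Hom(X, _)] is
   additive, [R] cancels in (1).
   For [t <> 0], the block matrix [diag(t, 1)] identifies the extensions of
   classes [Z] and [t Z], so [N + t Zhat] lies in the orbit of [L]; a polynomial
   vanishing on this punctured line vanishes at [t = 0], which is (2).
   If [L] and [N] are isomorphic then [W] and [N^p (+) N^q] have the same
   [dim Hom(N^q, _)], so the identity of [N^q] lifts to [W] and the sequence
   splits; conversely a coboundary is removed by the block matrix [1, h; 0, 1],
   which gives (3). *)
Require Import Defs.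
From HB Require Import structures.
From mathcomp Require Import all_boot all_order all_algebra.
From mathcomp Require Import mpoly.
Set Implicit Arguments.
Unset Strict Implicit.
Unset Printing Implicit Defensive.
Import GRing.Theory.
Local Open Scope ring_scope.

Section Homomorphisms.
Variables (k : fieldType) (Q : quiver).
Implicit Types X Y U V : rep k Q.

Lemma homQ_appP X Y (h : vhom X Y) :
  reflect (forall al x, h (tgt al) (rep_map X al x) = rep_map Y al (h (src al) x))
    (h \in homQ X Y).
Proof.
apply: (iffP (homQP h)) => [hh al x|hh al]; first by rewrite -!comp_lfunE hh.
by apply/lfunP=> x; rewrite !comp_lfunE hh.
Qed.

Definition postcomp X Y Y' (f : vhom Y Y') (h : vhom X Y) : vhom X Y' :=
  [ffun a => (f a \o h a)%VF].

Fact postcomp_is_linear X Y Y' (f : vhom Y Y') : linear (@postcomp X Y Y' f).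
Proof.
move=> c h h'; apply/ffunP=> a; rewrite !ffunE; apply/lfunP=> x.
by do ! rewrite ?lfunE /=; rewrite linearP.
Qed.
HB.instance Definition _ X Y Y' (f : vhom Y Y') :=
  GRing.isLinear.Build k _ _ _ (@postcomp X Y Y' f) (@postcomp_is_linear X Y Y' f).

Definition postcomp_lfun X Y Y' (f : vhom Y Y') : 'Hom(vhom X Y, vhom X Y') :=
  linfun (postcomp f).

Lemma postcomp_lfunE X Y Y' (f : vhom Y Y') (h : vhom X Y) :
  postcomp_lfun X f h = postcomp f h.
Proof. by rewrite lfunE. Qed.

Lemma postcomp_hom X Y Y' (f : vhom Y Y') (h : vhom X Y) :
  f \in homQ Y Y' -> h \in homQ X Y -> postcomp f h \in homQ X Y'.
Proof.
move=> /homQ_appP hf /homQ_appP hh; apply/homQ_appP=> al x.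
by rewrite !ffunE !comp_lfunE /= hh hf.
Qed.

Lemma postcomp_inj X Y Y' (f : vhom Y Y') :
  (forall a, lker (f a) = 0%VS) -> injective (@postcomp X Y Y' f).
Proof.
move=> f_inj h h' /ffunP eqh; apply/ffunP=> a; apply/lfunP=> x.
have /eqP/lker0P := f_inj a; apply.
by have /lfunP/(_ x) := eqh a; rewrite !ffunE !comp_lfunE.
Qed.

Lemma dim_limg_inj (aT rT : vectType k) (f : 'Hom(aT, rT)) (A : {vspace aT}) :
  injective f -> \dim (f @: A) = \dim A.
Proof. by move=> /lker0P/eqP f0; apply: limg_dim_eq; rewrite f0 capv0. Qed.

Lemma dim_hom_mono X Y Y' (f : vhom Y Y') :
    f \in homQ Y Y' -> (forall a, lker (f a) = 0%VS) ->
  (dim_hom X Y <= dim_hom X Y')%N.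
Proof.
move=> hf f_inj.
have <- : \dim (postcomp_lfun X f @: homQ X Y)%VS = dim_hom X Y.
  by apply: dim_limg_inj => h h'; rewrite !postcomp_lfunE; apply: postcomp_inj.
apply/dimvS/subvP=> _ /memv_imgP[h hh ->]; rewrite postcomp_lfunE.
exact: postcomp_hom.
Qed.

Lemma rep_iso_sym X Y : rep_iso X Y -> rep_iso Y X.
Proof.
case=> f [g [hf hg fgK]]; exists g, f; split=> // a.
by case: (fgK a).
Qed.

Lemma rep_iso_trans Y X V : rep_iso X Y -> rep_iso Y V -> rep_iso X V.
Proof.
case=> f [g [hf hg fgK]] [f' [g' [hf' hg' fgK']]].
exists (postcomp f' f), (postcomp g g'); split=> [||a];
  [exact: postcomp_hom|exact: postcomp_hom|].
have [gf fg] := fgK a; have [gf' fg'] := fgK' a; split.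
  by rewrite !ffunE -comp_lfunA (comp_lfunA (g' a)) gf' comp_lfun1l.
by rewrite !ffunE -comp_lfunA (comp_lfunA (f a)) fg comp_lfun1l.
Qed.

Lemma rep_iso_bij X Y (g : vhom X Y) :
    g \in homQ X Y -> (forall a, lker (g a) = 0%VS) ->
  (forall a, limg (g a) = fullv) -> rep_iso X Y.
Proof.
move=> hg g0 g1; pose f : vhom Y X := [ffun a => (g a)^-1%VF].
have fK a : cancel (f a) (g a).
  by move=> y; rewrite ffunE limg_lfunVK // g1 memvf.
have gK a : cancel (g a) (f a).
  by move=> x; rewrite ffunE lker0_lfunK // g0 eqxx.
exists g, f; split=> //; last first.
  by move=> a; split; apply/lfunP=> x; rewrite comp_lfunE id_lfunE ?fK ?gK.
move/homQ_appP: hg => hg; apply/homQ_appP=> al y.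
by rewrite -{1}[y]fK -hg gK.
Qed.

Lemma rep_iso_dim_hom Y Y' X : rep_iso Y Y' -> dim_hom X Y = dim_hom X Y'.
Proof.
case=> f [g [hf hg fgK]]; apply/eqP; rewrite eqn_leq.
rewrite (@dim_hom_mono _ _ _ f) ?(@dim_hom_mono _ _ _ g) // => a;
  have [/lfunP gf /lfunP fg] := fgK a; apply/eqP/lker0P.
  by apply: (can_inj (g := f a)) => x; rewrite -comp_lfunE fg id_lfunE.
by apply: (can_inj (g := g a)) => x; rewrite -comp_lfunE gf id_lfunE.
Qed.

End Homomorphisms.

Section Extensions.
Variables (k : fieldType) (Q : quiver).
Implicit Types X U V : rep k Q.

Lemma ext_repE U V (Z : Z1 V U) al (w : ext_rep Z (src al)) :
  rep_map (ext_rep Z) al w = (rep_map U al w.1 + Z al w.2, rep_map V al w.2).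
Proof. by rewrite lfunE. Qed.

Lemma dsumE U V al (w : dsum U V (src al)) :
  rep_map (dsum U V) al w = (rep_map U al w.1, rep_map V al w.2).
Proof. by rewrite ext_repE ffunE lfunE addr0. Qed.

Definition pair_fun (T A B : vectType k) (f : 'Hom(T, A)) (g : 'Hom(T, B)) x :=
  (f x, g x).
Fact pair_fun_is_linear T A B f g : linear (@pair_fun T A B f g).
Proof. by move=> c x y; rewrite /pair_fun !linearP. Qed.
HB.instance Definition _ T A B f g :=
  GRing.isLinear.Build k _ _ _ (@pair_fun T A B f g) (@pair_fun_is_linear T A B f g).

Definition vpair X U V (Z : Z1 V U) (h : vhom X U) (g : vhom X V) :
    vhom X (ext_rep Z) :=
  [ffun a => linfun (pair_fun (h a) (g a)) : 'Hom(X a, ext_rep Z a)].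

Lemma vpairE X U V (Z : Z1 V U) (h : vhom X U) (g : vhom X V) a x :
  vpair Z h g a x = (h a x, g a x).
Proof. by rewrite ffunE lfunE. Qed.

Lemma vpair_hom X U V (Z : Z1 V U) (h : vhom X U) (g : vhom X V) :
    g \in homQ X V ->
    (forall al x, h (tgt al) (rep_map X al x)
                  = rep_map U al (h (src al) x) + Z al (g (src al) x)) ->
  vpair Z h g \in homQ X (ext_rep Z).
Proof.
move=> /homQ_appP hg hZ; apply/homQ_appP=> al x.
by rewrite !vpairE lfunE /= /ext_map /= hZ hg.
Qed.

Local Notation pushforward X Z :=
  (postcomp_lfun X (can_proj Z) @: homQ X (ext_rep Z))%VS.

Lemma postcomp_can_projP X U V (Z : Z1 V U) (g : vhom X V) :
  reflect (exists2 h : vhom X U, g \in homQ X V &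
             forall al x, h (tgt al) (rep_map X al x)
                          = rep_map U al (h (src al) x) + Z al (g (src al) x))
    (g \in pushforward X Z).
Proof.
apply: (iffP memv_imgP) => [[w hw ->]|[h hg hZ]].
  rewrite postcomp_lfunE; exists [ffun a => (linfun fst \o w a)%VF].
    by apply: postcomp_hom hw; apply: can_proj_hom.
  move=> al x; rewrite !ffunE !comp_lfunE !lfunE /=.
  by move/homQ_appP: hw => ->; rewrite lfunE.
exists (vpair Z h g); first exact: vpair_hom.
rewrite postcomp_lfunE; apply/ffunP=> a; apply/lfunP=> x.
by rewrite !ffunE !comp_lfunE !lfunE.
Qed.

Lemma pushforward_sub X U V (Z : Z1 V U) : (pushforward X Z <= homQ X V)%VS.
Proof. by apply/subvP=> g /postcomp_can_projP[]. Qed.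

Lemma dim_hom_ext X U V (Z : Z1 V U) :
  dim_hom X (ext_rep Z) = (dim_hom X U + \dim (pushforward X Z))%N.
Proof.
rewrite /dim_hom -(limg_ker_dim (postcomp_lfun X (can_proj Z))); congr (_ + _)%N.
have inj_inj : injective (postcomp_lfun X (Defs.can_inj Z)).
  by move=> h h'; rewrite !postcomp_lfunE; apply: postcomp_inj; apply: can_injective.
rewrite -(dim_limg_inj (homQ X U) inj_inj); congr (\dim _).
apply/vspaceP=> w; rewrite memv_cap memv_ker postcomp_lfunE.
apply/andP/memv_imgP=> [[hw /eqP w0]|[h hh ->]].
  have w2 a x : (w a x).2 = 0.
    by move/ffunP/(_ a)/lfunP/(_ x): w0; rewrite !ffunE !lfunE /= lfunE.
  exists ([ffun a => (linfun fst \o w a)%VF] : vhom X U).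
    apply/homQ_appP=> al x; rewrite !ffunE !comp_lfunE !lfunE /=.
    by rewrite (elimT (homQ_appP w) hw); rewrite lfunE /= w2 linear0 addr0.
  rewrite postcomp_lfunE; apply/ffunP=> a; apply/lfunP=> x.
  rewrite !ffunE !comp_lfunE !lfunE /=.
  by rewrite /inl_fun -(w2 a x); case: (w a x).
rewrite postcomp_lfunE; split; first by apply: postcomp_hom hh; apply: can_inj_hom.
by apply/eqP/ffunP=> a; apply/lfunP=> x; rewrite !ffunE !comp_lfunE !lfunE.
Qed.

Lemma dim_hom_dsum X U V : dim_hom X (dsum U V) = (dim_hom X U + dim_hom X V)%N.
Proof.
rewrite dim_hom_ext; congr (_ + \dim _)%N; apply/eqP.
rewrite eqEsubv pushforward_sub; apply/subvP=> g hg.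
apply/postcomp_can_projP; exists 0 => // al x.
by rewrite !ffunE !lfunE linear0 addr0.
Qed.

(* Equal dimensions force [Hom(V, W) -> End(V)] to be onto, and a preimage of
   the identity is a splitting. *)
Lemma dim_hom_split U V (Z : Z1 V U) :
  dim_hom V (ext_rep Z) = dim_hom V (dsum U V) -> Z \in B1 V U.
Proof.
rewrite dim_hom_ext dim_hom_dsum => /addnI dimE.
have /eqP eqE : pushforward V Z == homQ V V.
  by rewrite eqEdim pushforward_sub dimE /=.
have: ([ffun a => \1%VF] : vhom V V) \in homQ V V.
  by apply/homQ_appP=> al x; rewrite !ffunE !id_lfunE.
rewrite -eqE => /postcomp_can_projP[h _ hZ].
apply/memv_imgP; exists h; rewrite ?memvf // lfunE.
apply/ffunP=> al; apply/lfunP=> x; rewrite ffunE add_lfunE opp_lfunE !comp_lfunE hZ.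
by rewrite ffunE id_lfunE addrAC subrr add0r.
Qed.

(* The block triangular change of basis [c, h; 0, 1]. *)
Lemma ext_rep_iso U V (Z : Z1 V U) (c : k) (h : vhom V U) :
  c != 0 -> rep_iso (ext_rep Z) (ext_rep (c *: Z + cobound_fun h)).
Proof.
move=> c0.
pose u : vhom (ext_rep Z) U :=
  [ffun a => (c *: (linfun fst : 'Hom(ext_rep Z a, U a)) + (h a \o can_proj Z a))%VF].
pose g := vpair (c *: Z + cobound_fun h) u (can_proj Z).
have gE a (w : ext_rep Z a) : g a w = (c *: w.1 + h a w.2, w.2).
  by rewrite vpairE !ffunE; do ! rewrite lfunE /=.
apply: (@rep_iso_bij _ _ _ _ g) => [|a|a].
- apply: vpair_hom; first exact: can_proj_hom.
  move=> al x; rewrite !ffunE; do ! rewrite ?ffunE ?lfunE /=.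
  rewrite !linearD linearZ /= -!addrA; congr (_ + _).
  by rewrite [X in _ = _ + X]addrA [RHS]addrC subrK.
- apply/eqP/lker0P=> -[x y] [x' y']; rewrite !gE /= => -[+ eqy].
  by rewrite eqy => /addIr/(scalerI c0)->.
apply/vspaceP=> -[x y]; rewrite memvf; apply/memv_imgP.
exists (c^-1 *: (x - h a y), y); rewrite ?memvf //.
by rewrite gE /= scalerA divff // scale1r subrK.
Qed.

Lemma dsum_isol (A A' B : rep k Q) : rep_iso A A' -> rep_iso (dsum A B) (dsum A' B).
Proof.
case=> f [f' [hf hf' ffK]].
pose u : vhom (dsum A B) A' := [ffun a => (f a \o linfun fst)%VF].
have gE a w : vpair 0 u (can_proj 0) a w = (f a w.1, w.2).
  by rewrite vpairE !ffunE !comp_lfunE !lfunE.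
apply: (@rep_iso_bij _ _ _ _ (vpair 0 u (can_proj 0))) => [|a|a].
- apply: vpair_hom; first exact: can_proj_hom.
  move=> al x; rewrite !ffunE !comp_lfunE !lfunE /= !ffunE !lfunE /= !addr0.
  by move/homQ_appP: hf => ->.
- apply/eqP/lker0P=> -[x y] [x' y']; rewrite !gE /= => -[+ ->].
  have [/lfunP ff _] := ffK a.
  by move/(congr1 (f' a)); rewrite -!comp_lfunE !ff !id_lfunE => ->.
apply/vspaceP=> -[x y]; rewrite memvf; apply/memv_imgP.
exists (f' a x, y); rewrite ?memvf // gE /= -comp_lfunE.
by have [_ ->] := ffK a; rewrite id_lfunE.
Qed.

End Extensions.

Section Matrices.
Variable k : fieldType.

Definition lfun_mx m n (f : 'Hom('cV[k]_n, 'cV[k]_m)) : 'M[k]_(m, n) :=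
  \matrix_(i, j) f (delta_mx j 0) i 0.

Lemma mul_lfun_mx m n (f : 'Hom('cV[k]_n, 'cV[k]_m)) x : lfun_mx f *m x = f x.
Proof.
apply/colP=> i; rewrite mxE {2}[x]matrix_sum_delta linear_sum summxE.
by apply: eq_bigr => j _; rewrite big_ord1 linearZ !mxE mulrC.
Qed.

Lemma mulmx_inj m n (A B : 'M[k]_(m, n)) :
  (forall x : 'cV[k]_n, A *m x = B *m x) -> A = B.
Proof.
move=> eqAB; apply/matrixP=> i j.
by have /colP/(_ i) := eqAB (delta_mx j 0); rewrite -!colE !mxE.
Qed.
End Matrices.

Section Decompositions.
Variables (k : fieldType) (Q : quiver) (d : vertex Q -> nat) (N : rep_pt k d).
Variables (S : finType) (D : decomposition S N).

Lemma sumv_pi_summand s t a v :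
  v \in summand D t a ->
  sumv_pi_for (summand_full D a) s v = if s == t then v else 0.
Proof.
move=> vt; have /directv_sum_unique uniqD := summand_direct D a.
have: \sum_s sumv_pi_for (summand_full D a) s v == \sum_s if s == t then v else 0.
  by rewrite sumv_pi_sum ?memvf // -big_mkcond big_pred1_eq.
rewrite uniqD => [/forall_inP/(_ s isT)/eqP //|i _|i _].
  exact: memv_sum_pi.
by case: eqP => [->|_]; rewrite ?mem0v.
Qed.

Variables (p q : S).
Hypothesis neq_pq : p <> q.

Definition rest_space a : {vspace 'cV[k]_(d a)} :=
  (\sum_(s | (s != p) && (s != q)) summand D s a)%VS.

Definition rest_rep : rep k Q :=
  @Rep k Q (fun a => subvs_of (rest_space a))
    (fun al => (linfun (vsproj (rest_space (tgt al)))
                \o linfun (mulmx (N al)) \o linfun vsval)%VF).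

Lemma mulmx_summand s al v :
  v \in summand D s (src al) -> N al *m v \in summand D s (tgt al).
Proof.
move=> vs; apply: (subvP (summand_stable D s al)).
by apply/memv_imgP; exists v; rewrite ?lfunE.
Qed.

Lemma mulmx_rest al v :
  v \in rest_space (src al) -> N al *m v \in rest_space (tgt al).
Proof.
case/memv_sumP=> vs vsP ->; rewrite mulmx_sumr; apply: memv_sumr => s Ps.
exact/mulmx_summand/vsP.
Qed.

Lemma sumv_pi_rest s a v : (s == p) || (s == q) ->
  v \in rest_space a -> sumv_pi_for (summand_full D a) s v = 0.
Proof.
move=> spq /memv_sumP[vs vsP ->]; rewrite linear_sum big1 // => t Pt.
rewrite /= (sumv_pi_summand _ (vsP t Pt)); case: (s =P t) Pt => // <-.
by rewrite -negb_or spq.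
Qed.

Section Glue.
Variable Z : Z1 (summand_rep D q) (summand_rep D p).
Local Notation W := (dsum (ext_rep Z) rest_rep).

Lemma val_summand_rep s al (v : summand_rep D s (src al)) :
  vsval (rep_map (summand_rep D s) al v) = N al *m vsval v.
Proof. by rewrite !comp_lfunE !lfunE /= vsprojK // mulmx_summand ?subvsP. Qed.

Lemma val_rest_rep al (v : rest_rep (src al)) :
  vsval (rep_map rest_rep al v) = N al *m vsval v.
Proof. by rewrite !comp_lfunE !lfunE /= vsprojK // mulmx_rest ?subvsP. Qed.

Definition glue_fun a (w : W a) : 'cV[k]_(d a) :=
  vsval w.1.1 + vsval w.1.2 + vsval w.2.

Fact glue_is_linear a : linear (@glue_fun a).
Proof.
move=> c w w'; rewrite /glue_fun /= !scalerDr.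
by rewrite [X in X + _ = _]addrACA [LHS]addrACA.
Qed.
HB.instance Definition _ a :=
  GRing.isLinear.Build k _ _ _ (@glue_fun a) (@glue_is_linear a).

Definition glue : vhom W (rep_of_pt (N + Zhat Z)) :=
  [ffun a => linfun (@glue_fun a) : 'Hom(W a, rep_of_pt (N + Zhat Z) a)].

Lemma glueE a (w : W a) : glue a w = vsval w.1.1 + vsval w.1.2 + vsval w.2.
Proof. by rewrite ffunE lfunE. Qed.

Lemma mulmx_Zhat al (x : 'cV[k]_(d (src al))) :
  Zhat Z al *m x
  = vsval (Z al (vsproj _ (sumv_pi_for (summand_full D (src al)) q x))).
Proof.
by rewrite ffunE mul_lfun_mx !comp_lfunE !lfunE.
Qed.

Lemma glue_hom : glue \in homQ W (rep_of_pt (N + Zhat Z)).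
Proof.
apply/homQ_appP=> al [[u v] r].
rewrite dsumE ext_repE !glueE [RHS]lfunE /= ffunE mulmxDl mulmx_Zhat !linearD /=.
rewrite (sumv_pi_summand _ (subvsP u)) (sumv_pi_summand _ (subvsP v)).
rewrite (sumv_pi_rest _ (subvsP r)) ?eqxx ?orbT //.
case: (q =P p) => [/esym//|_]; rewrite !linear0 add0r addr0 vsvalK.
rewrite val_rest_rep !val_summand_rep.
by rewrite [RHS]addrAC; congr (_ + _); rewrite addrAC.
Qed.

Lemma glue_inj a : lker (glue a) = 0%VS.
Proof.
apply/eqP; rewrite -subv0; apply/subvP=> -[[u v] r]; rewrite memv_ker glueE /=.
move=> /eqP uvr0; have := congr1 (sumv_pi_for (summand_full D a) p) uvr0.
have := congr1 (sumv_pi_for (summand_full D a) q) uvr0.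
rewrite !linearD /= !linear0 !(sumv_pi_summand _ (subvsP u)).
rewrite !(sumv_pi_summand _ (subvsP v)).
rewrite !(sumv_pi_rest _ (subvsP r)) ?eqxx ?orbT //.
move/eqP/negPf: neq_pq => pq; rewrite [q == p]eq_sym pq !addr0 add0r => v0 u0.
move: uvr0; rewrite u0 v0 !add0r memv0 => r0; apply/eqP.
by congr (_, _, _); apply: val_inj.
Qed.

Lemma glue_surj a : limg (glue a) = fullv.
Proof.
apply/vspaceP=> x; rewrite memvf; apply/memv_imgP.
pose pi s := sumv_pi_for (summand_full D a) s x.
exists ((vsproj _ (pi p), vsproj _ (pi q)),
        vsproj _ (\sum_(s | (s != p) && (s != q)) pi s)); rewrite ?memvf //.
rewrite glueE /= !vsprojK ?memv_sum_pi //; last first.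
  by apply: memv_sumr => s _; apply: memv_sum_pi.
rewrite -{1}(sumv_pi_sum (summand_full D a) (memvf x)) (bigD1 p) //=.
rewrite (bigD1 q) /= ?addrA //.
by apply/eqP=> /esym.
Qed.

Lemma rep_iso_glue : rep_iso W (rep_of_pt (N + Zhat Z)).
Proof. exact: rep_iso_bij glue_hom glue_inj glue_surj. Qed.

End Glue.
End Decompositions.

Lemma rep_iso_orbit (k : fieldType) (Q : quiver) (d : vertex Q -> nat)
    (L M : rep_pt k d) :
  rep_iso (rep_of_pt L) (rep_of_pt M) -> orbit_pt L M.
Proof.
case=> f [g [/homQ_appP hf _ fgK]].
pose G a : 'M_(d a) := lfun_mx (f a : 'Hom('cV_(d a), 'cV_(d a))).
have GU a : G a \in unitmx.
  suff /mulmx1_unit[] : G a *m lfun_mx (g a : 'Hom('cV_(d a), 'cV_(d a))) = 1%:M by [].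
  apply: mulmx_inj => x; rewrite -mulmxA !mul_lfun_mx mul1mx.
  by have [_ fg] := fgK a; rewrite -[LHS](comp_lfunE (f a)) fg id_lfunE.
exists G => // al; apply: (canRL (mulmxK (GU _))); apply: mulmx_inj => x.
by rewrite -!mulmxA !mul_lfun_mx; have := hf al x; rewrite !lfunE.
Qed.

Lemma zariski_closure_line (k : closedFieldType) (Q : quiver) (d : vertex Q -> nat)
    (A : rep_pt k d -> Prop) (N M : rep_pt k d) :
  (forall t, t != 0 -> A (N + t *: M)) -> zariski_closure A N.
Proof.
move=> lineA C [E defC] subAC; apply/defC=> f Ef.
pose P := mmap polyC (fun i => (coords N i)%:P + (coords M i)%:P * 'X) f.
have PE t : P.[t] = f.@[coords (N + t *: M)].
  rewrite /P /mmap mevalE horner_sum; apply: eq_bigr => m _.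
  rewrite hornerM hornerC /mmap1 horner_prod; congr (_ * _); apply: eq_bigr => i _.
  by rewrite horner_exp !hornerE /coords !ffunE !mxE mulrC.
suff P0 : P = 0 by rewrite -[N]addr0 -(scale0r M) -PE P0 horner0.
apply/eqP; rewrite -[_ == 0]orbF -(polyX_eq0 k) -mulf_eq0.
apply: contraT => /closed_nonrootP[t].
rewrite rootM rootX negb_or => /andP[Pt t0]; case/negP: Pt.
by rewrite /root PE; apply/eqP; move/subAC/defC: (lineA t t0); apply.
Qed.

Lemma Zhat_scale (k : fieldType) (Q : quiver) (d : vertex Q -> nat) (N : rep_pt k d)
    (S : finType) (D : decomposition S N) (p q : S)
    (Z : Z1 (summand_rep D q) (summand_rep D p)) t : Zhat (t *: Z) = t *: Zhat Z.
Proof.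
apply/ffunP=> al; rewrite !ffunE; apply/matrixP=> i j.
by rewrite !mxE !comp_lfunE scale_lfunE linearZ mxE.
Qed.

Theorem lemma3p2 (k : closedFieldType) (Q : quiver) (hQ : dynkin Q)
    (d : vertex Q -> nat) (N : rep_pt k d)
    (S : finType) (D : decomposition S N) (p q : S) (hpq : p <> q)
    (Z : Z1 (summand_rep D q) (summand_rep D p)) :
  let L : rep_pt k d := N + Zhat Z in
  [/\ delta (rep_of_pt L) (rep_of_pt N) =1 delta_ses (sigma Z),
      zariski_closure (orbit_pt L) N
    & rep_iso (rep_of_pt L) (rep_of_pt N)
        <-> Z \in B1 (summand_rep D q) (summand_rep D p)].
Proof.
move=> L; pose R := rest_rep D p q.
have isoL (Y : Z1 (summand_rep D q) (summand_rep D p)) :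
      rep_iso (dsum (ext_rep Y) R) (rep_of_pt (N + Zhat Y)).
  exact: rep_iso_glue hpq Y.
have isoN : rep_iso (dsum (dsum (summand_rep D p) (summand_rep D q)) R) (rep_of_pt N).
  have Zhat0 : Zhat (0 *: Z) = 0 by rewrite Zhat_scale scale0r.
  by have := isoL 0; rewrite -[in Zhat _](scale0r Z) Zhat0 addr0.
have dimL X : dim_hom X (rep_of_pt L) = (dim_hom X (ext_rep Z) + dim_hom X R)%N.
  by rewrite -(rep_iso_dim_hom X (isoL Z)) dim_hom_dsum.
have dimN X : dim_hom X (rep_of_pt N)
    = (dim_hom X (dsum (summand_rep D p) (summand_rep D q)) + dim_hom X R)%N.
  by rewrite -(rep_iso_dim_hom X isoN) dim_hom_dsum.
split=> [X||].
- by rewrite /delta_ses /delta dimL dimN !PoszD opprD addrACA subrr addr0.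
- apply: (zariski_closure_line (M := Zhat Z)) => t t0; rewrite -Zhat_scale.
  apply/rep_iso_orbit/(rep_iso_trans (rep_iso_sym (isoL Z)))/(rep_iso_trans _ (isoL _)).
  apply: dsum_isol; have := ext_rep_iso Z 0 t0.
  by rewrite linear0 addr0.
split=> [isoLN|/memv_imgP[h _ Zh]].
  apply: dim_hom_split; apply/(@addIn (dim_hom (summand_rep D q) R)).
  by rewrite -dimL -dimN; apply: rep_iso_dim_hom.
apply: (rep_iso_trans (rep_iso_sym (isoL Z))); apply: rep_iso_trans isoN.
apply/dsum_isol/rep_iso_sym; have := ext_rep_iso 0 h (oner_neq0 k).
by rewrite scaler0 add0r Zh lfunE.
Qed.
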